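(* Let $M\ge 1$ and $K\ge 1$ be integers and $\rho>0$. Let $\mathbf{h}_1,\ldots,\mathbf{h}_K$ be i.i.d. random vectors with $\mathbf{h}_k\sim\mathcal{CN}(\mathbf{0},\mathbf{I}_M)$, so that each $X_k=\|\mathbf{h}_k\|^2$ has CDF $F_X(x)=1-\Gamma(M,x)/\Gamma(M)$ for $x\ge 0$. Let $\gamma=\rho\min_{1\le k\le K}X_k$ and $g(\gamma)=1+\gamma$, and define the Mellin transform $\mathcal{M}_{g(\gamma)}(s)=\mathbb{E}\left[g(\gamma)^{s-1}\right]=\int_0^\infty(1+\rho x)^{s-1}\,\mathrm{d}F_{X_{(1)}}(x)$, where $X_{(1)}=\min_{1\le k\le K}X_k$. Then for $s<1$, $$\mathcal{M}_{g(\gamma)}(s)=1+(s-1)\sum_{k_1+\cdots+k_M=K}\frac{\varphi\,\Gamma(1+\vartheta)}{\rho^{\vartheta}}\,U\!\left(\vartheta+1,\ \vartheta+s,\ K/\rho\right),$$ where the sum runs over all $M$-tuples $(k_1,\ldots,k_M)$ of nonnegative integers with $k_1+\cdots+k_M=K$, and for each such tuple $$\varphi=\frac{\binom{K}{k_1,k_2,\ldots,k_M}}{\prod_{n=0}^{M-1}(n!)^{k_{n+1}}},\qquad \vartheta=\sum_{\ell=0}^{M-1}\ell\, k_{\ell+1}.$$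
   Context: $\Gamma(a,x)=\int_x^\infty t^{a-1}e^{-t}\,\mathrm{d}t$ is the upper incomplete gamma function and $\Gamma(a)=\Gamma(a,0)$. $\binom{K}{k_1,\ldots,k_M}=\frac{K!}{k_1!\cdots k_M!}$ is the multinomial coefficient. $U(a,b,z)$ denotes Tricomi's confluent hypergeometric function of the second kind (also written $\Psi(a;b;z)$), which for $a>0$, $z>0$ has the integral representation $U(a,b,z)=\frac{1}{\Gamma(a)}\int_0^\infty e^{-zt}t^{a-1}(1+t)^{b-a-1}\,\mathrm{d}t$. The notation $\mathcal{CN}(\mathbf{0},\mathbf{I}_M)$ denotes a circularly symmetric complex Gaussian vector in $\mathbb{C}^M$ with identity covariance. *)

(* Defs.v *)
From HB Require Import structures.
From mathcomp Require Import all_boot all_order all_algebra.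
From mathcomp Require Import all_classical all_reals all_analysis.
Set Implicit Arguments. Unset Strict Implicit. Unset Printing Implicit Defensive.
Import Order.TTheory GRing.Theory Num.Theory.
Local Open Scope classical_set_scope.
Local Open Scope ring_scope.

Definition upper_gamma {R : realType} (a x : R) : R :=
  Rintegral lebesgue_measure `[x, +oo[ (fun t : R => t `^ (a - 1) * expR (- t)).

Definition Gamma {R : realType} (a : R) : R := upper_gamma a 0.

(* Tricomi's U(a,b,z) via its integral representation (valid for a>0, z>0):
   U(a,b,z) = 1/Gamma(a) int_0^oo e^(-z t) t^(a-1) (1+t)^(b-a-1) dt. *)
Definition tricomiU {R : realType} (a b z : R) : R :=
  (Gamma a)^-1 * Rintegral lebesgue_measure `[0, +oo[
    (fun t : R => expR (- (z * t)) * t `^ (a - 1) * (1 + t) `^ (b - a - 1)).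

Definition mutually_independent {d} {T : measurableType d} {R : realType}
  (P : probability T R) (K : nat) (X : nat -> {RV P >-> R}) : Prop :=
  forall (J : {set 'I_K}) (B : 'I_K -> set R),
    (forall j, measurable (B j)) ->
    P (\big[setI/setT]_(j in J) (X j @^-1` B j)) =
    (\prod_(j in J) P (X j @^-1` B j))%E.

(* CDF of ||h||^2 for h ~ CN(0, I_M):  F_X(x) = 1 - Gamma(M,x)/Gamma(M), x >= 0. *)
Definition FX {R : realType} (M : nat) (x : R) : R :=
  1 - upper_gamma M%:R x / Gamma M%:R.

(* X_(1) = min_{k<K} X_k (meaningful for K >= 1). *)
Definition Xmin {d} {T : measurableType d} {R : realType}
  (P : probability T R) (K : nat) (X : nat -> {RV P >-> R}) (w : T) : R :=
  \big[Num.min/X 0%N w]_(k < K) X k w.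

(* multinomial coefficient part phi for a tuple k = (k_1,...,k_M), k_{n+1} = k n *)
Definition phi_coef {R : realType} (M K : nat) (k : 'I_M -> nat) : R :=
  (K`!)%:R / (\prod_(i < M) ((k i)`!)%:R) / \prod_(n < M) ((n`!)%:R ^+ k n).

Definition vartheta (M : nat) (k : 'I_M -> nat) : nat :=
  \sum_(l < M) l * k l.

(* Main.v *)
(* Since (1 + x)^(s-1) is the integral over t >= x of (1 - s)(1 + t)^(s-2), Tonelli
   turns the expectation of (1 + rho Xmin)^(s-1) into the integral over t >= 0 of
   (1 - s)(1 + t)^(s-2) P(Xmin <= t/rho).  By independence and repeated integration
   by parts of the incomplete gamma function,
   P(Xmin > u) = (e^(-u) sum_(i < M) u^i/i!)^K,
   and the multinomial theorem expands this as a sum of the terms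
   phi u^theta e^(-K u), each of which contributes one Tricomi integral. *)
Require Import Defs.
From HB Require Import structures.
From mathcomp Require Import all_boot all_order all_algebra.
From mathcomp Require Import all_classical all_reals all_analysis measurable_realfun.
From mathcomp Require Import ring.
Import Order.TTheory GRing.Theory Num.Theory.
Import numFieldNormedType.Exports.
Local Open Scope classical_set_scope.
Local Open Scope ring_scope.

(** * Multinomial expansion in divided powers *)

(* Both sides are the coefficient of X^N in the product over i of the truncated
   exponential series of a_i X. *)
Lemma multinomial_divided_powers (R : numFieldType) (I : finType)
    (a : I -> R) (N : nat) :
  (\sum_i a i) ^+ N / N`!%:R =
  \sum_(k : {ffun I -> 'I_N.+1} | (\sum_i (k i : nat))%N == N)
    \prod_i (a i ^+ k i / (k i)`!%:R).
Proof.
have natf0 n : n`!%:R != 0 :> R by rewrite pnatr_eq0 -lt0n fact_gt0.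
pose E i : {poly R} := \sum_(j < N.+1) (a i ^+ j / j`!%:R) *: 'X^j.
have EE i : E i = \poly_(j < N.+1) (a i ^+ j / j`!%:R) by rewrite poly_def.
(* The truncation at degree N does not affect coefficients of degree n <= N, and the Cauchy product
   for degree n only uses degrees at most n. The bound is therefore stable under the induction on
   [r]. *)
have coefE (r : seq I) n : (n <= N)%N ->
    (\prod_(i <- r) E i)`_n = (\sum_(i <- r) a i) ^+ n / n`!%:R.
  elim: r n => [|i r IH] n nN.
    rewrite !big_nil coefC; case: n {nN} => [|n]; last by rewrite expr0n mul0r.
    by rewrite expr0 fact0 divr1.
  rewrite !big_cons coefM addrC exprDn mulr_suml; apply: eq_bigr => j _.
  have jn : (j <= n)%N by rewrite -ltnS.
  rewrite EE coef_poly ltnS (leq_trans jn nN) IH; last first.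
    by rewrite (leq_trans _ nN)// leq_subr.
  have /(congr1 (fun m => m%:R : R)) := bin_fact jn.
  rewrite !natrM -mulr_natr => <-.
  have : 'C(n, j)%:R != 0 :> R by rewrite pnatr_eq0 -lt0n bin_gt0.
  by move: (natf0 j) (natf0 (n - j)%N) => ? ? ?; field; apply/and3P; split.
(* Distributing the product over the sums picks one exponent [k i] per index; the coefficient of X^N
   keeps exactly the choices of total N. *)
rewrite -coefE// bigA_distr_bigA coef_sum [RHS]big_mkcond /=.
apply: eq_bigr => k _.
have -> : \prod_i ((a i ^+ k i / (k i)`!%:R) *: 'X^(k i))
   = (\prod_i (a i ^+ k i / (k i)`!%:R)) *: 'X^(\sum_i k i) :> {poly R}.
  by rewrite scaler_prod -expr_sum.
by rewrite coefZ coefXn eq_sym; case: ifP => _; rewrite ?mulr1// mulr0.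
Qed.

(** * Upper incomplete gamma function at positive integers *)

(** Since x^(n+1)/(n+1)! < e^x for x > 0, the function is squeezed between 0 and (n+1)!/x. *)
Lemma cvg_expn_mul_expRN (R : realType) (n : nat) :
  (fun x : R => x ^+ n * expR (- x)) x @[x --> +oo%R] --> (0 : R).
Proof.
have : (n.+1`!%:R * x^-1 : R) @[x --> +oo%R] --> (n.+1`!%:R * 0 : R).
  apply: cvgMl_tmp; apply/(@gtr0_cvgV0 _ _ _ _ id); last exact: cvg_id.
  exact: nbhs_pinfty_gt.
rewrite mulr0; apply: squeeze_cvgr; last exact: cvg_cst.
near=> x; have x0 : 0 < x by near: x; exact: nbhs_pinfty_gt.
rewrite mulr_ge0 ?expR_ge0 ?exprn_ge0 ?ltW//=.
rewrite expRN ltr_pdivrMr ?expR_gt0// mulrAC ltr_pdivlMr// -exprSr.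
rewrite -ltr_pdivrMl ?ltr0n ?fact_gt0// mulrC.
by apply: lt_le_trans (expR_ge1Dxn n (ltW x0)); rewrite ltrDr.
Unshelve. all: by end_near. Qed.

Lemma is_derive1_continuous (R : realType) (f : R -> R) (x df : R) :
  is_derive x 1 f df -> {for x, continuous f}.
Proof.
by move=> fx; apply/differentiable_continuous/derivable1_diffP; exact: ex_derive.
Qed.

(** The repeated integrations by parts are packed into a single antiderivative, a polynomial times
    -e^(-t), which vanishes at infinity. *)
Lemma upper_gammaS (R : realType) (n : nat) (x : R) : 0 <= x ->
  upper_gamma n.+1%:R x =
  n`!%:R * (expR (- x) * \sum_(k < n.+1) x ^+ k / k`!%:R).
Proof.
move=> x0.
pose p : {poly R} := \poly_(k < n.+1) (n`!%:R / k`!%:R).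
(* F' = e^(-t) (p - p'), so p is chosen with p - p' = X^n. *)
pose F (t : R) := - (expR (- t) * p.[t]).
have pE : p - p^`() = 'X^n.
  apply/polyP => k; rewrite coefB coef_deriv !coef_poly coefXn ltnS.
  have natf0 m : m`!%:R != 0 :> R by rewrite pnatr_eq0 -lt0n fact_gt0.
  (* For k < n the coefficients n!/k! and (k+1) n!/(k+1)! cancel; at k = n only n!/n! = 1 remains;
     above n both vanish. *)
  have [kn|nk|->] := ltngtP k n; rewrite ?ltnS ?ltnn ?mul0rn ?subr0 ?divff//.
  - rewrite kn factS natrM -[_ *+ _]mulr_natr.
    have : k.+1%:R != 0 :> R by rewrite pnatr_eq0.
    by move: (natf0 k) => ? ?; rewrite /=; field; apply/andP; split.
  - by rewrite ltnNge ltnW// mul0rn subr0.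
have dF (t : R) : is_derive t 1 F (t ^+ n * expR (- t)).
  have dN : is_derive t 1 (expR \o -%R : R -> R) (expR (- t) * - 1).
    exact: is_derive1_comp.
  have -> : F = - ((expR \o -%R) * horner p) by [].
  apply: is_derive_eq; rewrite -![_ *: _]/(_ * _) /=.
  by rewrite -hornerXn -pE hornerD hornerN; ring.
have cF (t : R) : {for t, continuous F} := is_derive1_continuous _ _ _ _ (dF t).
transitivity (\int[lebesgue_measure]_(t in `[x, +oo[) (t ^+ n * expR (- t))).
  apply: eq_Rintegral => t; rewrite inE /= in_itv /= andbT => xt.
  by rewrite -natr1 addrK powR_mulrn// (le_trans x0).
rewrite (@Rintegral_ge0_continuous_FTC2y _ _ F _ 0).
- rewrite sub0r /F opprK [RHS]mulrCA /p horner_poly; congr (_ * _).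
  by rewrite mulr_sumr; apply: eq_bigr => k _; rewrite mulrAC mulrA.
- by move=> t xt; rewrite mulr_ge0 ?expR_ge0 ?exprn_ge0 ?(le_trans x0).
- apply: continuous_subspaceT => t; apply: cvgM; first exact: exprn_continuous.
  by apply: (is_derive1_continuous _ (expR \o -%R)); exact: is_derive1_comp.
(* The limit of [F] at infinity is 0, monomial by monomial of [p]. *)
- rewrite -oppr0; apply: cvgN.
  rewrite [X in X @ _ --> _](_ : _ = fun t : R =>
      \sum_(k < n.+1) n`!%:R / k`!%:R * (t ^+ k * expR (- t))); last first.
    apply/funext => t; rewrite /p horner_poly mulr_sumr.
    by apply: eq_bigr => k _; ring.
  suff : (fun t : R => \sum_(k < n.+1) n`!%:R / k`!%:R * (t ^+ k * expR (- t)))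
      x @[x --> +oo] --> \sum_(k < n.+1) n`!%:R / k`!%:R * (0 : R).
    by rewrite [X in _ --> X -> _]big1// => k _; rewrite mulr0.
  apply: cvg_big => [|k _]; first exact: add_continuous.
  by apply: cvgMl_tmp; exact: cvg_expn_mul_expRN.
- by move=> t _; exact: ex_derive.
- by apply: cvg_at_right_filter; exact: cF.
- by move=> t _; rewrite derive1E; case: (dF t).
Qed.

(** * The power (1 + x)^(s-1) as a tail integral *)

(** The antiderivative -(1 + t)^(s-1) tends to 0 at infinity because s < 1, so only its value at x
    contributes. *)
Lemma integral_powR1D (R : realType) (s x : R) : s < 1 -> 0 <= x ->
  (\int[lebesgue_measure]_(t in `[x, +oo[)
     ((1 - s) * (1 + t) `^ (s - 2))%:E)%E = ((1 + x) `^ (s - 1))%:E.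
Proof.
move=> s1 x0; pose F (t : R) := - (1 + t) `^ (s - 1).
have dF (t : R) : 0 <= t -> is_derive t 1 F ((1 - s) * (1 + t) `^ (s - 2)).
  move=> t0; have t1 : 0 < 1 + t by rewrite ltr_pwDl.
  have -> : F = - ((@powR R ^~ (s - 1)) \o (fun t => 1 + t)) by [].
  have d1 : is_derive t 1 (fun t : R => 1 + t) 1.
    have -> : (fun t : R => 1 + t) = cst 1 + id by [].
    by apply: is_derive_eq; rewrite add0r.
  have dp : is_derive (1 + t) 1 (@powR R ^~ (s - 1)) _ := is_derive1_powR _ t1.
  apply: is_derive_eq; rewrite mulr1 -mulNr opprB; congr (_ * _ `^ _); ring.
have cG (t : R) : 0 <= t ->
    {for t, continuous (fun t : R => (1 - s) * (1 + t) `^ (s - 2))}.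
  move=> t0; have t1 : 0 < 1 + t by rewrite ltr_pwDl.
  apply: cvgMl_tmp; apply: (@continuous_comp _ _ _ (fun t : R => 1 + t)
    (@powR R ^~ (s - 2))).
    by apply: cvgD; [exact: cvg_cst|exact: cvg_id].
  exact: is_derive1_continuous _ _ _ _ (is_derive1_powR _ t1).
rewrite (@ge0_continuous_FTC2y _ _ F _ 0).
- by rewrite -EFinB sub0r opprK.
- by move=> t _; rewrite mulr_ge0 ?powR_ge0// subr_ge0 ltW.
- apply/continuous_within_itvcyP; split.
    by move=> t; rewrite in_itv/= andbT => /ltW xt; exact/cG/(le_trans x0).
  by apply: cvg_at_right_filter; exact: cG.
- rewrite -oppr0; apply: cvgN; apply/cvgr0Pnorm_lt => e e0.
  near=> t; have t0 : 0 < t by near: t; exact: nbhs_pinfty_gt.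
  (* With [e] the tolerance, this threshold is the root of y^(s-1) = e; then y = 1 + t lies beyond
     it. *)
  have te : e^-1 `^ (1 - s)^-1 < t by near: t; exact: nbhs_pinfty_gt.
  rewrite ger0_norm ?powR_ge0// -opprB powRN invf_plt ?posrE ?powR_gt0//;
    last by rewrite ltr_pwDl// ltW.
  have s0 : 0 < 1 - s by rewrite subr_gt0.
  have -> : e^-1 = (e^-1 `^ (1 - s)^-1) `^ (1 - s).
    by rewrite -powRrM mulVf ?gt_eqF// powRr1// invr_ge0 ltW.
  apply: gt0_ltr_powR; rewrite ?nnegrE ?powR_ge0 ?addr_ge0 ?(ltW t0)//.
  by rewrite (lt_trans te)// ltrDr.
- by move=> t /ltW xt; have [] := dF t (le_trans x0 xt).
- apply: cvg_at_right_filter; exact: is_derive1_continuous _ _ _ _ (dF _ x0).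
- move=> t; rewrite in_itv/= andbT => /ltW xt.
  by rewrite derive1E; case: (dF t (le_trans x0 xt)).
Unshelve. all: by end_near. Qed.

(** * Tail integrals and the law of the minimum *)

Lemma measurable_bigmin d (T : measurableType d) (R : realType)
    (I : Type) (r : seq I) (f : I -> T -> R) (g : T -> R) :
  measurable_fun setT g -> (forall i, measurable_fun setT (f i)) ->
  measurable_fun setT (fun w => \big[Num.min/g w]_(i <- r) f i w).
Proof.
move=> mg mf; elim: r => [|i r IH].
  by under eq_fun do rewrite big_nil.
by under eq_fun do rewrite big_cons; exact: measurable_minr.
Qed.

(** The moving domain t >= Z(w) is absorbed into an indicator on the product space. Tonelli then
    applies, and integrating the indicator over w gives P(Z <= t). *)
Lemma integral_tail_tonelli d (T : measurableType d) (R : realType)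
    (P : probability T R) (Z : T -> R) (g : R -> R) :
  measurable_fun setT Z -> (forall w, 0 <= Z w) ->
  measurable_fun setT g -> (forall t, 0 <= g t) ->
  (\int[P]_w \int[lebesgue_measure]_(t in `[Z w, +oo[) (g t)%:E =
   \int[lebesgue_measure]_(t in `[0%R, +oo[)
     ((g t)%:E * P [set w | (Z w <= t)%R]))%E.
Proof.
move=> mZ Z0 mg g0.
pose b (z : T * R) : bool := Z z.1 <= z.2.
have mb : measurable_fun setT b.
  by apply: measurable_fun_ler => //; exact: measurableT_comp.
pose f (z : T * R) := (if b z then g z.2 else 0)%:E.
have mf : measurable_fun setT f.
  apply/measurable_EFinP; apply: measurable_fun_ifT => //.
  exact: measurableT_comp.
have f0 z : (0 <= f z)%E by rewrite /f lee_fin; case: ifP.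
transitivity (\int[P]_w \int[lebesgue_measure]_t f (w, t))%E.
  apply: eq_integral => w _; rewrite integral_mkcond; apply: eq_integral => t _.
  by rewrite patchE mem_setE in_itv /= andbT /f /b /=; case: ifP.
rewrite fubini_tonelli// [RHS]integral_mkcond; apply: eq_integral => t _.
rewrite patchE mem_setE in_itv /= andbT.
have mA : measurable [set w | (Z w <= t)%R].
  rewrite -[X in measurable X]setTI.
  exact: (mZ measurableT _ (measurable_itv `]-oo, t])).
have [t0|t0] := leP 0 t.
  rewrite -(setIT [set w | _]) -integral_indic// -ge0_integralZl//.
  - apply: eq_integral => w _; rewrite /f /b /= indicE -EFinM.
    case: ifP => Zt; first by rewrite mem_set// mulr1.
    by rewrite memNset/= ?Zt// mulr0.
  - exact/measurable_EFinP/measurable_indic.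
  - by rewrite lee_fin.
(* For t < 0 the right side is the default value of a restricted function, which is 0; the left side
   is 0 too, since Z >= 0 leaves no w with Z(w) <= t. *)
have -> : point = 0%E :> \bar R by [].
by apply: integral0_eq => w _; rewrite /f /b /= leNgt (lt_le_trans t0).
Qed.

(** The minimum exceeds u exactly when every X_k does; independence is then used with the full index
    set. *)
Lemma prob_gt_Xmin d (T : measurableType d) (R : realType)
    (P : probability T R) (K : nat) (X : nat -> {RV P >-> R}) (u : R) :
  (0 < K)%N -> mutually_independent K X ->
  P [set w | u < Xmin K X w] = (\prod_(k < K) ccdf (X k) u)%E.
Proof.
move=> K0 /(_ [set: 'I_K]%SET (fun=> `]u, +oo[%classic)) indep.
have -> : [set w | u < Xmin K X w] =
    \big[setI/setT]_(j in [set: 'I_K]%SET) (X j @^-1` `]u, +oo[).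
  rewrite -bigcap_seq_cond; apply/seteqP; split => w /=.
    move=> /bigmin_gtP[_ uX] k /= _; rewrite in_itv/= andbT; exact: uX.
  have inX (k : 'I_K) : (\bigcap_(j in [set j | (j \in index_enum 'I_K) &&
      (j \in [set: 'I_K]%SET)]) X j @^-1` `]u, +oo[) w -> u < X k w.
    move=> /(_ k); rewrite /= mem_index_enum finset.in_setT in_itv/= andbT; exact.
  (* [bigmin_gtP] also compares u with the default X_0 of the minimum; as K > 0, that default is one
     of the K variables. *)
  move=> Xw; apply/bigmin_gtP; split; first exact: (inX (Ordinal K0)).
  by move=> k _; exact: inX.
rewrite indep//; apply: eq_bigl => k; exact: finset.in_setT.
Qed.

(** * Truncated exponential series and the coefficients phi *)

(** Partial sums of a series with nonnegative terms lie below its limit. This later bounds e^(-u)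
    times the truncated series by 1. *)
Lemma exp_partial_sum_le_expR (R : realType) (n : nat) (x : R) : 0 <= x ->
  \sum_(k < n) x ^+ k / k`!%:R <= expR x.
Proof.
move=> x0; rewrite -(big_mkord xpredT (fun k => x ^+ k / k`!%:R)).
apply: (nondecreasing_cvgn_le _ (is_cvg_series_exp_coeff x)).
apply/nondecreasing_seqP => m.
by rewrite /series /= big_nat_recr//= lerDl exp_coeff_ge0.
Qed.

Lemma GammaS (R : realType) (n : nat) : Gamma n.+1%:R = n`!%:R :> R.
Proof.
rewrite /Gamma upper_gammaS// oppr0 expR0 mul1r big_ord_recl big1.
  by rewrite expr0 fact0 divr1 addr0 mulr1.
by move=> k _; rewrite expr0n mul0r.
Qed.

(** This is [multinomial_divided_powers] at a_i = u^i/i!, multiplied by K!: the factorials gather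
    into phi, the powers of u into u^theta. *)
Lemma exprn_sum_phi_coef (R : realType) (M K : nat) (u : R) :
  (\sum_(i < M) u ^+ i / i`!%:R) ^+ K =
  \sum_(k : {ffun 'I_M -> 'I_K.+1} | (\sum_(i < M) (k i : nat))%N == K)
    phi_coef K (fun i => k i : nat) * u ^+ vartheta (fun i => k i : nat).
Proof.
have K0 : K`!%:R != 0 :> R by rewrite pnatr_eq0 -lt0n fact_gt0.
rewrite -[LHS](divfK K0) multinomial_divided_powers mulr_suml; apply: eq_bigr => k _.
rewrite /phi_coef /vartheta expr_sum mulrC -!mulrA -!prodfV -!big_split /=.
congr (_ * _); apply: eq_bigr => i _.
by rewrite exprMn exprVn exprM mulrC; congr (_ * _); rewrite mulrC.
Qed.

Lemma phi_coef_gt0 (R : realType) (M K : nat) (k : 'I_M -> nat) :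
  0 < phi_coef K k :> R.
Proof.
have fact0 n : 0 < n`!%:R :> R by rewrite ltr0n fact_gt0.
by rewrite /phi_coef !divr_gt0// prodr_gt0// => i _; rewrite exprn_gt0.
Qed.

(** * Termwise integration into Tricomi functions *)

Lemma Rintegral_sum d (T : measurableType d) (R : realType)
    (mu : {measure set T -> \bar R}) (D : set T) (I : Type) (r : seq I)
    (P : pred I) (f : I -> T -> R) :
  measurable D -> (forall i, P i -> mu.-integrable D (EFin \o f i)) ->
  \int[mu]_(x in D) (\sum_(i <- r | P i) f i x) =
  \sum_(i <- r | P i) \int[mu]_(x in D) f i x.
Proof.
move=> mD intf.
have intS s : mu.-integrable D (EFin \o (fun x => \sum_(i <- s | P i) f i x)).
  have := integrable_sum mD s intf; apply: eq_integrable => // x _.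
  by rewrite /= sumEFin.
elim: r => [|i r IH].
  rewrite big_nil /Rintegral integral0_eq// => x _.
  by rewrite big_nil.
rewrite big_cons; case: ifPn => Pi; last first.
  by rewrite -IH; apply: eq_Rintegral => x _; rewrite big_cons (negbTE Pi).
rewrite -IH -RintegralD//; last exact: intf.
by apply: eq_Rintegral => x _; rewrite big_cons Pi.
Qed.

(** The weight [w] has total mass 1, which gives the leading 1. The product [w * S] expands into
    finitely many Tricomi integrands, and integrability of each one allows the integral to be
    split. *)
Lemma integral_powR1D_ccdf (R : realType) (M K : nat) (rho s : R) :
  0 < rho -> s < 1 ->
  (\int[lebesgue_measure]_(t in `[0%R, +oo[)
     ((1 - s) * (1 + t) `^ (s - 2) *
      (1 - (expR (- (t / rho)) *
            \sum_(i < M) (t / rho) ^+ i / i`!%:R) ^+ K))%:E)%E =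
  (1 + (s - 1) *
     \sum_(k : {ffun 'I_M -> 'I_K.+1} | (\sum_(i < M) (k i : nat))%N == K)
        (phi_coef K (fun i => k i : nat)
         * Gamma (1 + (vartheta (fun i => k i : nat))%:R)
         / rho ^+ vartheta (fun i => k i : nat)
         * tricomiU ((vartheta (fun i => k i : nat))%:R + 1)
                    ((vartheta (fun i => k i : nat))%:R + s) (K%:R / rho)))%:E.
Proof.
move=> rho0 s1.
pose D : set (measurableTypeR R) := [set` `[0%R, +oo[].
pose w (t : R) := (1 - s) * (1 + t) `^ (s - 2).
pose S (t : R) :=
  (expR (- (t / rho)) * \sum_(i < M) (t / rho) ^+ i / i`!%:R) ^+ K.
pose th (k : {ffun 'I_M -> 'I_K.+1}) := vartheta (fun i => k i : nat).
pose c (k : {ffun 'I_M -> 'I_K.+1}) : R :=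
  phi_coef K (fun i => k i : nat) / rho ^+ th k.
(* The exponents are left unsimplified to match the integrand of [tricomiU] at a = theta + 1, b =
   theta + s; they equal theta and s - 2. *)
pose b (k : {ffun 'I_M -> 'I_K.+1}) (t : R) :=
  expR (- (K%:R / rho * t)) * t `^ ((th k)%:R + 1 - 1) *
  (1 + t) `^ ((th k)%:R + s - ((th k)%:R + 1) - 1).
have D0 t : D t -> 0 <= t by rewrite /D /= in_itv/= andbT.
have s0 : 0 < 1 - s by rewrite subr_gt0.
have c0 k : 0 < c k by rewrite divr_gt0 ?phi_coef_gt0 ?exprn_gt0.
have b0 k t : 0 <= b k t by rewrite !mulr_ge0 ?powR_ge0 ?expR_ge0.
have w0 t : 0 <= w t by rewrite mulr_ge0 ?powR_ge0// ltW.
have mD : measurable D by exact: measurable_itv.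
have wS t : D t -> w t * S t =
    \sum_(k : {ffun 'I_M -> 'I_K.+1} | (\sum_(i < M) (k i : nat))%N == K)
      (1 - s) * c k * b k t.
  move=> /D0 t0.
  (* The K-th power turns e^(-t/rho) into e^(-(K/rho) t), and u = t/rho contributes the factor
     rho^(-theta) held in [c]. *)
  rewrite /S exprMn exprn_sum_phi_coef -expRM_natl mulr_sumr mulr_sumr.
  apply: eq_bigr => k _.
  rewrite /b /w /c addrK powR_mulrn// exprMn exprVn.
  have -> : (th k)%:R + s - ((th k)%:R + 1) - 1 = s - 2 by ring.
  have -> : K%:R * - (t / rho) = - (K%:R / rho * t) by ring.
  by rewrite -/(th k); ring.
have S1 t : D t -> S t <= 1.
  move=> /D0 t0; have u0 : 0 <= t / rho by rewrite divr_ge0// ltW.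
  have sum0 : 0 <= \sum_(i < M) (t / rho) ^+ i / i`!%:R.
    by apply: sumr_ge0 => i _; rewrite divr_ge0// exprn_ge0.
  rewrite exprn_ile1 ?mulr_ge0 ?expR_ge0// expRN mulrC.
  by rewrite ler_pdivrMr ?expR_gt0// mul1r exp_partial_sum_le_expR.
have m1D p : measurable_fun D (fun t : R => (1 + t) `^ p).
  apply: measurable_funTS; apply: (measurableT_comp (measurable_powR p)).
  exact: measurable_funD.
have intw : lebesgue_measure.-integrable D (EFin \o w).
  apply/integrableP; split.
    apply/measurable_EFinP.
    by apply: measurable_funM; [exact: measurable_cst|exact: m1D].
  under eq_integral do rewrite /= ger0_norm//.
  by rewrite integral_powR1D// ltry.
have mb k : measurable_fun D (b k).
  apply: measurable_funM; last exact: m1D.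
  apply: measurable_funTS; apply: measurable_funM; last exact: measurable_powR.
  apply: (measurableT_comp (@measurable_expR R)).
  by apply: measurableT_comp => //; exact: measurable_funM.
(* (1 - s) c_k b_k is one of the nonnegative terms of w S <= w. *)
have intb (k : {ffun 'I_M -> 'I_K.+1}) : (\sum_(i < M) (k i : nat))%N == K ->
    lebesgue_measure.-integrable D (EFin \o b k).
  move=> Kk.
  refine (@le_integrable _ _ _ lebesgue_measure D mD (EFin \o b k)
    (fun t => ((1 - s) * c k)^-1%:E * (EFin \o w) t)%E _ _ _).
  - by apply/measurable_EFinP; exact: mb.
  - move=> t Dt; rewrite /comp -EFinM !abse_EFin lee_fin ger0_norm//.
    rewrite ger0_norm; last first.
      by rewrite mulr_ge0// invr_ge0 mulr_ge0 ?ltW.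
    rewrite ler_pdivlMl; last exact: mulr_gt0.
    apply: (@le_trans _ _ (w t * S t)); last by rewrite ler_piMr// S1.
    rewrite wS// (bigD1 k)//= lerDl sumr_ge0// => k' _.
    by rewrite mulr_ge0// mulr_ge0// ltW.
  - exact: integrableZl.
have intbZ (k : {ffun 'I_M -> 'I_K.+1}) : (\sum_(i < M) (k i : nat))%N == K ->
    lebesgue_measure.-integrable D (EFin \o (fun t => (1 - s) * c k * b k t)).
  move=> /intb ib; have := integrableZl mD ((1 - s) * c k) ib.
  exact: eq_integrable.
have intS : lebesgue_measure.-integrable D (EFin \o (fun t => w t * S t)).
  have := integrable_sum mD (index_enum _) intbZ; apply: eq_integrable => // t.
  by rewrite inE => Dt; rewrite /= sumEFin wS.
transitivity (\int[lebesgue_measure]_(t in D) (w t - w t * S t))%:E.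
  rewrite fineK; last exact/integrable_fin_num/(integrableB mD intw intS).
  by apply: eq_integral => t _; rewrite mulrBr mulr1.
rewrite RintegralB//; congr EFin; congr (_ + _).
  by rewrite /Rintegral integral_powR1D// addr0 powR1.
rewrite -[s - 1]opprB mulNr; congr (- _).
rewrite [LHS](_ : _ = \int[lebesgue_measure]_(t in D)
    \sum_(k : {ffun 'I_M -> 'I_K.+1} | (\sum_(i < M) (k i : nat))%N == K)
      (1 - s) * c k * b k t); last first.
  by apply: eq_Rintegral => t; rewrite inE; exact: wS.
rewrite Rintegral_sum// mulr_sumr; apply: eq_bigr => k Kk.
rewrite RintegralZl//; last exact: intb.
(* The factor Gamma(1 + theta) cancels the normalisation 1/Gamma(a) of U: both gamma values are
   theta!. *)
rewrite -[LHS]mulrA; congr (_ * _); rewrite /tricomiU -/(th k) nat1r GammaS /c.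
have -> : Gamma ((th k)%:R + 1) = (th k)`!%:R :> R by rewrite natr1 GammaS.
have thf : (th k)`!%:R != 0 :> R by rewrite pnatr_eq0 -lt0n fact_gt0.
have rf : rho ^+ th k != 0 by rewrite expf_neq0// gt_eqF.
rewrite -/(b k) -/D -/(th k); set I := Rintegral _ _ _.
by field; apply/andP.
Qed.

(** * From the expectation to the tail integral *)

Theorem theorem1 (R : realType) (d : measure_display) (T : measurableType d)
  (P : probability T R) (M K : nat) (rho s : R)
  (X : nat -> {RV P >-> R}) :
  (1 <= M)%N -> (1 <= K)%N -> 0 < rho ->
  mutually_independent K X ->
  (forall k, (k < K)%N -> forall x : R, 0 <= x -> cdf (X k) x = (FX M x)%:E) ->
  s < 1 ->
  ('E_P[fun w => ((1 + rho * Xmin K X w) `^ (s - 1))%R])%E =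
  (1 + (s - 1) *
     \sum_(k : {ffun 'I_M -> 'I_K.+1} | (\sum_(i < M) (k i : nat))%N == K)
        (phi_coef K (fun i => k i : nat) * Gamma (1 + (vartheta (fun i => k i : nat))%:R)
         / rho ^+ vartheta (fun i => k i : nat)
         * tricomiU ((vartheta (fun i => k i : nat))%:R + 1)
                    ((vartheta (fun i => k i : nat))%:R + s) (K%:R / rho)))%:E.
Proof.
move=> M0 K0 rho0 indepX cdfX s1.
have mX : measurable_fun setT (Xmin K X).
  by apply: measurable_bigmin => [|k]; exact: measurable_funPT.
have survX (u : R) : 0 <= u -> P [set w | u < Xmin K X w] =
    ((expR (- u) * \sum_(i < M) u ^+ i / i`!%:R) ^+ K)%:E.
  move=> u0; rewrite prob_gt_Xmin//.
  rewrite (eq_bigr (fun=> (expR (- u) * \sum_(i < M) u ^+ i / i`!%:R)%:E)).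
    by rewrite prodEFin prodr_const card_ord.
  move=> k _; rewrite ccdf_1_cdf cdfX// -EFinB /FX opprB addrC subrK.
  (* With M = n + 1, Gamma(M) = n! cancels the factor n! in the closed form of Gamma(M, u). *)
  case: M M0 => // n _ in cdfX *.
  by rewrite upper_gammaS// GammaS mulrAC divff ?mul1r// pnatr_eq0 -lt0n fact_gt0.
have mgt u : measurable [set w | u < Xmin K X w].
  rewrite -[X in measurable X]setTI.
  rewrite (_ : [set w | _] = Xmin K X @^-1` `]u, +oo[%classic).
    exact: mX.
  by apply/seteqP; split => w; rewrite /= in_itv/= andbT.
(* The CDF determines X_k only up to a null set, where the minimum could be negative. Clipping at 0
   gives the pointwise nonnegativity that the tail formula and Tonelli require. *)
pose Z (w : T) : R := Num.max 0 (rho * Xmin K X w).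
have mZ : measurable_fun setT Z.
  by apply: measurable_maxr => //; exact: measurable_funM.
have Z0 w : 0 <= Z w by rewrite le_max lexx.
have m1D (f : T -> R) : measurable_fun setT f ->
    measurable_fun setT (fun w => (1 + f w) `^ (s - 1)).
  move=> mf; apply: (measurableT_comp (measurable_powR (s - 1))).
  exact: measurable_funD.
have survZ t : 0 <= t -> P [set w | Z w <= t] = (1 -
    (expR (- (t / rho)) * \sum_(i < M) (t / rho) ^+ i / i`!%:R) ^+ K)%:E.
  move=> t0; rewrite EFinB -survX; last by rewrite divr_ge0// ltW.
  have -> : [set w | Z w <= t] = ~` [set w | t / rho < Xmin K X w].
    apply/seteqP; split=> w /=; rewrite ge_max t0/= ltr_pdivrMr// mulrC;
      by [move=> ?; apply/negP; rewrite -leNgt|move/negP; rewrite -leNgt].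
  exact: probability_setC.
(* Clipping changes nothing where the minimum is positive. That event has probability 1: at u = 0
   only the term i = 0 of the truncated series survives, and it equals 1. *)
have XZ : {ae P, forall w, [set: T] w ->
    ((1 + rho * Xmin K X w) `^ (s - 1))%:E = ((1 + Z w) `^ (s - 1))%:E}.
  exists (~` [set w | 0 < Xmin K X w]); split.
  - exact: measurableC.
  - rewrite -[LHS]/(P _) probability_setC// survX//.
    case: M M0 => // n _ in cdfX survX survZ *.
    rewrite oppr0 expR0 mul1r big_ord_recl big1 => [|i _].
      by rewrite expr0 fact0 divr1 addr0 expr1n subee.
    by rewrite expr0n mul0r.
  - move=> w /=; apply: contra_not => X0 _.
    by rewrite /Z max_r// mulr_ge0// ltW.
rewrite unlock.
rewrite (ge0_ae_eq_integral _ _ _ _ _ XZ)//.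
- transitivity (\int[P]_w \int[lebesgue_measure]_(t in `[Z w, +oo[)
      ((1 - s) * (1 + t) `^ (s - 2))%:E)%E.
    by apply: eq_integral => w _; rewrite integral_powR1D.
  rewrite integral_tail_tonelli//.
  + rewrite -integral_powR1D_ccdf//; apply: eq_integral => t.
    by rewrite inE /= in_itv/= andbT => t0; rewrite survZ.
  + apply: measurable_funM => //; apply: (measurableT_comp (measurable_powR _)).
    exact: measurable_funD.
  + by move=> t; rewrite mulr_ge0 ?powR_ge0// subr_ge0 ltW.
- by apply/measurable_EFinP/m1D; exact: measurable_funM.
- exact/measurable_EFinP/m1D.
- by move=> w _; rewrite lee_fin powR_ge0.
- by move=> w _; rewrite lee_fin powR_ge0.
Qed.
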